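(* For each nonnegative integer $k$, \[\sum_{n\geq 0}|\mathsf{Pop}^k(\mathcal{O}(\mathsf{C}_n))|\,x^n=\frac{1-x^{k+1}-\sqrt{(1-x^{k+1})^2-4x(1-x)(1-x^{k+1})}}{2x(1-x)}.\]
   Context: $\mathsf{C}_n$ is the chain with $n$ elements, viewed as a rooted tree (a path) whose root is the top element; for $n=0$ the lattice $\mathcal{O}(\mathsf{C}_0)$ has exactly one element. For a rooted tree $\mathsf{T}$ (poset with the root as maximum, each non-root node covered by its parent), an ornament is a nonempty set of nodes inducing a connected subgraph, and an ornamentation is a map $\delta$ from nodes to ornaments such that the maximal element of $\delta(v)$ is $v$ and any two sets $\delta(v),\delta(v')$ are nested or disjoint. $\mathcal{O}(\mathsf{T})$ is the set of ornamentations ordered by $\delta\leq\delta'$ iff $\delta(v)\subseteq\delta'(v)$ for all $v$; it is a lattice with meet given by pointwise intersection. (For $\mathsf{T}=\mathsf{C}_n$ this is the $n$-th Tamari lattice.) The pop-stack operator is $\mathsf{Pop}(\delta)=\bigwedge(\{\delta\}\cup\{\delta':\delta'\lessdot\delta\})$, and $\mathsf{Pop}^k$ is its $k$-th iterate ($\mathsf{Pop}^0$ the identity). *)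

(* Defs.v *)
From mathcomp Require Import all_boot.
Set Implicit Arguments. Unset Strict Implicit. Unset Printing Implicit Defensive.

Section Ornaments.
Variable T : finType.
(* cov x y : x is covered by y in the rooted tree (y is the parent of x). *)
Variable cov : rel T.

Definition tle (x y : T) : bool := connect cov x y.

Definition adj (x y : T) : bool := cov x y || cov y x.

Definition connected_set (S : {set T}) : bool :=
  [forall x in S, forall y in S,
     connect [rel a b | [&& a \in S, b \in S & adj a b]] x y].

Definition ornament (S : {set T}) : bool := (S != set0) && connected_set S.

Definition max_is (S : {set T}) (v : T) : bool :=
  (v \in S) && [forall u in S, tle u v].

Definition nested_or_disjoint (A B : {set T}) : bool :=
  [|| A \subset B, B \subset A | [disjoint A & B]].

Definition ornamentation (d : {ffun T -> {set T}}) : bool :=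
  [forall v, ornament (d v) && max_is (d v) v] &&
  [forall v, forall v', nested_or_disjoint (d v) (d v')].

Definition Orn : {set {ffun T -> {set T}}} := [set d | ornamentation d].

Definition ole (d d' : {ffun T -> {set T}}) : bool :=
  [forall v, d v \subset d' v].

Definition olt (d d' : {ffun T -> {set T}}) : bool := (d != d') && ole d d'.

Definition ocovered (d' d : {ffun T -> {set T}}) : bool :=
  [&& d' \in Orn, d \in Orn, olt d' d &
      [forall e in Orn, ~~ (olt d' e && olt e d)]].

(* Pop(d) = meet of {d} u {d' : d' covered by d}; meets in O(T) are
   pointwise intersections. *)
Definition Pop (d : {ffun T -> {set T}}) : {ffun T -> {set T}} :=
  [ffun v => d v :&: \bigcap_(d' | ocovered d' d) d' v].

Definition PopImage (k : nat) : {set {ffun T -> {set T}}} :=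
  [set iter k Pop d | d in Orn].

End Ornaments.

Definition chain_cov (n : nat) : rel 'I_n := fun i j => val j == (val i).+1.

Definition popChainCount (k n : nat) : nat := #|@PopImage 'I_n (@chain_cov n) k|.

(* Main.v *)
Require Import Defs.
From HB Require Import structures.
From mathcomp Require Import all_boot zify.
Set Implicit Arguments. Unset Strict Implicit. Unset Printing Implicit Defensive.

(* An ornamentation of the chain is a bracket vector [s], with [s v] one less
   than the size of the ornament at [v]; equivalently it is a plane forest
   listed in postorder, that is, a Dyck word.  Every [v] with [s v > 0] yields
   exactly one lower cover, which removes the first child of [v] from its
   ornament, and [Pop] performs all these removals at once.  On Dyck words
   with [P = U^a D w_1 D w_2 ... D w_a] this reads
   [Pop P = UD . U (Pop w_1) D ... U (Pop w_(a-1)) D . Pop w_a].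
   Call a component [U q D] trivial when [q] is empty.  By induction on [k], a
   word is in the image of [Pop^k] iff its first nontrivial component is
   preceded by at least [k] trivial ones, two successive nontrivial sibling
   components are separated by at least [k-1] trivial ones, and (if [k > 0])
   every nonempty nested word starts with a trivial component.  If [G_m] counts
   the words in which the first requirement asks for [m] trivial components,
   then [G_(m+1) = 1 + x G_m] and, for [k > 0], [G_0 = 1 + x G_0 + x (G_1 - 1) G_(k-1)],
   whence [F = G_k] satisfies [(1 - x^(k+1)) (F - 1) = x (1 - x) F^2].  Near
   [0] the bound [4^n] on the coefficients selects the root of this equation. *)

(** * Forests, and the pop operator on them *)

(* [Node q r] is the Dyck word [U q D r]. *)
Inductive tree : Type := Leaf | Node of tree & tree.

Fixpoint tree_size (t : tree) : nat :=
  if t is Node q r then (tree_size q + tree_size r).+1 else 0.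

Fixpoint code (t : tree) : seq nat :=
  if t is Node q r then code q ++ tree_size q :: code r else [::].

Lemma size_code t : size (code t) = tree_size t.
Proof. by elim: t => //= q IHq r IHr; rewrite size_cat /= IHq IHr addnS. Qed.

Lemma nth_code_le t i : nth 0 (code t) i <= i.
Proof.
elim: t i => [|q IHq r IHr] i /=; first by rewrite nth_nil.
rewrite nth_cat size_code; case: ltnP => // le_qi.
case E: (i - tree_size q) => [|j] /=; first by lia.
by have := IHr j; lia.
Qed.

(* The root of the first component is the last index [v] whose entry is [v]. *)
Lemma code_inj : injective code.
Proof.
have lt_root q r q' r' : code (Node q r) = code (Node q' r') -> tree_size q' <= tree_size q.
  move=> eq_c; rewrite leqNgt; apply/negP => lt_qq'.
  have: nth 0 (code (Node q r)) (tree_size q') = tree_size q'.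
    by rewrite eq_c /= nth_cat size_code ltnn subnn.
  rewrite /= nth_cat size_code ltnNge ltnW //=.
  case E: (tree_size q' - tree_size q) => [|j] /=; first by lia.
  by have := nth_code_le r j; lia.
elim=> [|q IHq r IHr] [|q' r'] //= eq_c.
- by move/(congr1 size): eq_c; rewrite size_cat /= addnS.
- by move/(congr1 size): eq_c; rewrite size_cat /= addnS.
have eq_sz : tree_size q = tree_size q'.
  apply/eqP; rewrite eqn_leq (lt_root _ _ _ _ eq_c).
  by rewrite (lt_root q' r' q r (esym eq_c)).
have /eqP := eq_c; rewrite eqseq_cat ?size_code // eqseq_cons.
by case/and3P=> /eqP/IHq-> _ /eqP/IHr->.
Qed.

HB.instance Definition _ := Equality.copy tree (inj_type code_inj).

(** The ornament of [v] is the interval from [v - s v] to [v]; the second clause says that any [u]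
    in it has its whole interval in it. The additive form avoids truncated subtraction. *)
Definition bracketing (n : nat) (s : nat -> nat) : Prop :=
  (forall v, v < n -> s v <= v) /\
  (forall u v, u <= v -> v < n -> v <= u + s v -> v + s u <= u + s v).

Lemma code_bracketing t : bracketing (tree_size t) (nth 0 (code t)).
Proof.
split=> [v _|]; first exact: nth_code_le.
elim: t => [|q IHq r IHr] u v //= le_uv lt_v.
rewrite !nth_cat size_code; case: (ltnP v) => [lt_vq|le_qv].
  by rewrite (leq_ltn_trans le_uv lt_vq); apply: IHq.
case: (ltnP u) => [lt_uq|le_qu].
  have := nth_code_le q u; case E: (v - tree_size q) => [|j] /=; first by lia.
  by have := nth_code_le r j; lia.
case Ev: (v - tree_size q) => [|j] /=; case Eu: (u - tree_size q) => [|i] /=; try lia.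
  by have := nth_code_le r j; lia.
have := IHr i j; have := nth_code_le r j; have := nth_code_le r i; lia.
Qed.

(** Split at the last [v] with [s v = v], the root of the first component: the entries before it
    give [q], those after it give [r]. *)
Lemma bracketing_code n s : bracketing n s ->
  exists2 t, tree_size t = n & forall i, i < n -> nth 0 (code t) i = s i.
Proof.
elim/ltn_ind: n s => -[|n] IHn s [s_le s_nest]; first by exists Leaf.
have ex_root : exists v, (v < n.+1) && (s v == v).
  by exists 0; have := s_le 0 isT; rewrite leqn0 => /eqP->.
have root_le v : (v < n.+1) && (s v == v) -> v <= n by case/andP.
case: (ex_maxnP ex_root root_le) => v /andP[lt_vn /eqP s_v] max_v.
have [q q_sz q_s] : exists2 q, tree_size q = v & forall i, i < v -> nth 0 (code q) i = s i.
  apply: IHn => //; split=> [w lt_wv|u w le_uw lt_wv]; first by apply: s_le; lia.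
  by apply: s_nest => //; lia.
(* If the interval of a later [w] reached down to [v], it would contain that of [v] and so reach
   [0], against the maximality of [v]. *)
have s_gt w : v < w -> w < n.+1 -> s w < w - v.
  move=> lt_vw lt_wn; rewrite ltnNge; apply/negP => le_s.
  have s_w : s w = w by have := s_nest v w; have := s_le w lt_wn; lia.
  by have := max_v w; rewrite lt_wn s_w eqxx => /(_ isT); lia.
have [r r_sz r_s] : exists2 r, tree_size r = n - v &
    forall i, i < n - v -> nth 0 (code r) i = s (v.+1 + i).
  apply: IHn; first by lia.
  split=> [w lt_w|u w le_uw lt_w le_w]; first by have := s_gt (v.+1 + w); lia.
  by have := s_nest (v.+1 + u) (v.+1 + w); lia.
exists (Node q r) => [|i lt_in] /=; first by lia.
rewrite nth_cat size_code q_sz; case: ltnP => [/q_s//|le_vi].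
case E: (i - v) => [|j] /=; first by have -> : i = v by lia.
by rewrite r_s; [congr (s _); lia | lia].
Qed.

(* For [q = U^(a-1) D w_1 ... D w_(a-1)], [spine f q X] is the word
   [UD . U (f w_1) D ... U (f w_(a-1)) D . X]. *)
Definition spine (f : tree -> tree) :=
  fix spine q X := if q is Node q1 r1 then spine q1 (Node (f r1) X) else Node Leaf X.

Fixpoint pop (t : tree) : tree :=
  if t is Node q r then spine pop q (pop r) else Leaf.

(* [u] is the root of the first child of [v], and [a] what is left of [s v] without that child. *)
Definition popat (s : nat -> nat) (v a : nat) : Prop :=
  (s v = 0 /\ a = 0) \/
  exists u, [/\ v = (u + a).+1, u + s v = v + s u &
    forall w, u < w < v -> w + s v <> v + s w].

Definition popseq (s s' : seq nat) : Prop :=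
  size s' = size s /\ forall v, v < size s -> popat (nth 0 s) v (nth 0 s' v).

Lemma popseq_cat s1 s1' s2 s2' :
  popseq s1 s1' -> popseq s2 s2' -> popseq (s1 ++ s2) (s1' ++ s2').
Proof.
move=> [sz1 pop1] [sz2 pop2]; split=> [|v]; first by rewrite !size_cat sz1 sz2.
rewrite size_cat /popat !nth_cat sz1 => lt_v.
case: ltnP => [lt_v1|le_1v].
  case: (pop1 v lt_v1) => [//|[u [Ev Eu max_u]]]; first by left.
  right; exists u; split=> //; first by rewrite nth_cat ifT //; lia.
  by move=> w lt_w; rewrite nth_cat ifT; [apply: max_u | lia].
case: (pop2 (v - size s1)) => [||[u [Ev Eu max_u]]]; [by lia | by left |].
right; exists (size s1 + u); split; [by lia | |].
  by rewrite nth_cat ifF ?addKn; lia.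
move=> w lt_w; rewrite nth_cat ifF; last by lia.
by have := max_u (w - size s1); lia.
Qed.

Lemma popseq_code_pop t : popseq (code t) (code (pop t)).
Proof.
(* For the induction, [c] is the part of the spine before [X]; it is the pop of the block [U t D],
   whose code ends with the root entry [tree_size t]. *)
suff [] : popseq (code t) (code (pop t)) /\
  exists2 c, popseq (rcons (code t) (tree_size t)) c &
    forall X, code (spine pop t X) = c ++ code X by [].
elim: t => [|q [_ [c pop_c code_c]] r [pop_r _]].
  split=> //; exists [:: 0] => //; split=> // -[|//] _; by left.
split; first by rewrite /= code_c -cat_rcons; apply: popseq_cat.
have [sz_c _] := pop_c; rewrite size_rcons size_code in sz_c.
have [sz_r _] := pop_r; rewrite !size_code in sz_r.
exists (rcons (c ++ code (pop r)) (tree_size r)); last first.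
  by move=> X; rewrite /= code_c /= cat_rcons -catA sz_r.
have pop_cr := popseq_cat pop_c pop_r.
split=> [|v]; first
  by rewrite size_rcons size_cat sz_c /= size_rcons size_cat /= !size_code sz_r; lia.
rewrite /= -cat_rcons size_rcons size_cat size_rcons !size_code addSn ltnS leq_eqVlt.
set s := rcons (code q) (tree_size q) ++ code r.
have sz_s : size s = (tree_size q + tree_size r).+1 by rewrite size_cat size_rcons !size_code.
have sz_cr : size (c ++ code (pop r)) = (tree_size q + tree_size r).+1.
  by rewrite size_cat sz_c size_code sz_r.
rewrite /popat !nth_rcons sz_s sz_cr.
case: eqVneq => [-> _|_ /= lt_v].
  rewrite ltnn; right; exists (tree_size q); split; first by lia.
    rewrite nth_rcons sz_s ifT; last by lia.
    by rewrite /s nth_cat size_rcons size_code leqnn nth_rcons size_code ltnn eqxx; lia.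
  move=> w lt_w; rewrite nth_rcons sz_s ifT; last by lia.
  rewrite /s nth_cat size_rcons size_code ifF; last by lia.
  by have := nth_code_le r (w - (tree_size q).+1); lia.
rewrite lt_v; case: pop_cr => _ /(_ v); rewrite -/s sz_s => /(_ lt_v).
case=> [|[u [Ev Eu max_u]]]; [by left | right; exists u; split=> //].
  by rewrite nth_rcons sz_s ifT //; lia.
by move=> w lt_w; rewrite nth_rcons sz_s ifT; [apply: max_u | lia].
Qed.

Lemma tree_size_pop t : tree_size (pop t) = tree_size t.
Proof. by have [] := popseq_code_pop t; rewrite !size_code. Qed.

(* The first nontrivial component must be preceded by at least [m] trivial ones.
   [0 < k] stands for [minn k 1], and [k.-1] truncates at [k = 0], where all words are good. *)
Fixpoint good (k m : nat) (t : tree) : bool :=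
  match t with
  | Leaf => true
  | Node Leaf r => good k m.-1 r
  | Node q r => [&& m == 0, good k (0 < k) q & good k k.-1 r]
  end.

Lemma good_Node k m q r : good k m (Node q r) =
  if q == Leaf then good k m.-1 r else [&& m == 0, good k (0 < k) q & good k k.-1 r].
Proof. by case: eqP => [->|]; case: q. Qed.

Lemma good_le k m m' t : m <= m' -> good k m' t -> good k m t.
Proof.
elim: t m m' => // q _ r IHr m m' le_mm'; rewrite !good_Node; case: eqP => _.
  by apply: IHr; lia.
by case/and3P=> /eqP m'0 -> ->; rewrite m'0 in le_mm'; rewrite -leqn0 le_mm'.
Qed.

Lemma good0 t : good 0 0 t.
Proof. by elim: t => //= -[|q1 q2] IHq r IHr //; rewrite IHq. Qed.

Lemma tree_size_eq0 t : (tree_size t == 0) = (t == Leaf).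
Proof. by case: t => [|q r] /=; [rewrite !eqxx | apply/esym/eqP]. Qed.

(** A spine starts with [UD], the one trivial component required; for [k = 1] nothing is required
    between siblings. *)
Lemma good_pop1 t : good 1 1 (pop t).
Proof.
suff [] : good 1 1 (pop t) /\
  forall X, good 1 0 X -> good 1 1 (spine pop t X) by [].
elim: t => [|q [_ IHq] r [IHr _]] //; split=> [|X gX]; first exact/IHq/(good_le _ IHr).
by apply: IHq; rewrite good_Node; case: eqP => //; rewrite IHr gX.
Qed.

(** As [k > 0], a nontrivial component of a good word is [U (UD r1) D], which [pop] turns into
    [UD . U (pop r1) D]: each one gains a trivial component in front. *)
Lemma good_popS k m t : 0 < k -> good k m t -> good k.+1 m.+1 (pop t).
Proof.
move=> k_gt0; have [l] := ubnP (tree_size t); elim: l m t => // l IHl m [|q r] //= lt_l.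
case: q lt_l => [|[|q1 q2] r1] /= lt_l; last 1 first.
- by rewrite k_gt0 /= andbF.
- move=> gr; case: m gr => [|m] gr; last by apply: IHl => //; lia.
  by apply: (@good_le _ _ 1) => //; apply: IHl => //; lia.
rewrite k_gt0 => /and3P[/eqP-> gr1 gr].
have {}gr : good k.+1 k (pop r) by have := IHl k.-1 r; rewrite prednK //; apply=> //; lia.
change (good k.+1 0 (Node (pop r1) (pop r))); rewrite good_Node.
case: eqP => _; first exact: good_le gr.
by rewrite gr andbT /=; apply: IHl => //; lia.
Qed.

(** [q'] is [q] with its leftmost leaf replaced by [Node Leaf r]. This is how preimages under [pop]
    are built, one component at a time. *)
Lemma spine_Node q r : exists q', forall X Y,
  spine pop q X = Node Leaf Y -> spine pop q' X = Node Leaf (Node (pop r) Y).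
Proof.
elim: q => [|q1 [q' IHq] r1 _] /=; first by exists (Node Leaf r) => X Y /= [->].
by exists (Node q' r1) => X Y /= /IHq.
Qed.

Lemma good1_pop s : good 1 1 s -> exists t, pop t = s.
Proof.
suff [] : (good 1 1 s -> exists t, pop t = s) /\
  (good 1 0 s -> exists q, spine pop q Leaf = Node Leaf s) by [].
elim: s => [|q [IHq _] r [_ IHr]].
  by split=> _; [exists Leaf | exists Leaf].
rewrite !good_Node; split.
  by case: eqP => [-> /IHr[q' Eq']|_ /andP[]//]; exists (Node q' Leaf).
move=> gs.
have [t Et] : exists t, pop t = q.
  by move: gs; case: eqP => [-> _|_ /and3P[_ gq _]]; [exists Leaf | exact: IHq].
have [q1 Eq1] : exists q1, spine pop q1 Leaf = Node Leaf r.
  by apply: IHr; move: gs; case: eqP => [_ //|_ /and3P[]].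
have [q' Eq'] := spine_Node q1 t; exists q'.
by rewrite (Eq' _ _ Eq1) Et.
Qed.

Lemma goodS_pop k m s : 0 < k -> good k.+1 m.+1 s ->
  exists2 t, good k m t & pop t = s.
Proof.
move=> k_gt0; have [l] := ubnP (tree_size s).
elim: l m s => // l IHl m [|[|q1 q2] s] lt_l gs.
- by exists Leaf.
- have {}gs : good k.+1 m s by [].
  (* The leading [UD] is kept if [s] has enough trivial components without it. Otherwise [m = 0] and
     the nontrivial component that follows absorbs it, giving [U (UD r1) D r2]. *)
  have [gs'|ngs'] := boolP (good k.+1 m.-1.+1 s).
    by have [t gt <-] := IHl m.-1 s lt_l gs'; exists (Node Leaf t).
  case: m gs ngs' => [|m] gs; last by rewrite gs.
  case: s gs lt_l => [//|q r]; rewrite !good_Node; case: eqP => [_ -> //|_].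
  case/and3P=> _ gq gr /= lt_l _.
  have [r1 gr1 <-] : exists2 r1, good k 0 r1 & pop r1 = q by apply: IHl => //; lia.
  have [r2 gr2 <-] : exists2 r2, good k k.-1 r2 & pop r2 = r.
    by apply: IHl; [lia | rewrite prednK].
  by exists (Node (Node Leaf r1) r2) => //=; rewrite k_gt0 /= gr1.
- by [].
Qed.

Lemma good_iter_pop k t : good k k t <-> exists t0, iter k pop t0 = t.
Proof.
elim: k t => [|k IHk] t; first by split=> [_|_]; [exists t | exact: good0].
(* [good 0] asks nothing of nested words, so [good_popS] does not cover the first pop. *)
case: (posnP k) => [->|k_gt0].
  by split=> [/good1_pop//|[t0 <-]]; exact: good_pop1.
split=> [/(goodS_pop k_gt0)[t1 /IHk[t0 <-] <-]|[t0 <-]]; first by exists t0.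
by rewrite iterS; apply: good_popS => //; apply/IHk; exists t0.
Qed.

(** * Counting forests *)

(** Fuel replaces the non-structural recursion on the sizes [i] and [n' - i]; any fuel above [n]
    gives the same list. *)
Fixpoint trees_fuel (f n : nat) : seq tree :=
  if f is f'.+1 then
    if n is n'.+1 then
      flatten [seq [seq Node q r | q <- trees_fuel f' i, r <- trees_fuel f' (n' - i)]
              | i <- iota 0 n]
    else [:: Leaf]
  else [::].

Definition trees (n : nat) : seq tree := trees_fuel n.+1 n.

Lemma trees_fuelS f n : trees_fuel f.+1 n.+1 =
  flatten [seq [seq Node q r | q <- trees_fuel f i, r <- trees_fuel f (n - i)]
          | i <- iota 0 n.+1].
Proof. by []. Qed.

Lemma trees_fuelE f n : n < f -> trees_fuel f n = trees n.
Proof.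
rewrite /trees; have [l] := ubnP n; elim: l f n => // l IHl [|f] // [|n] // lt_l lt_f.
rewrite !trees_fuelS; congr flatten.
apply/eq_in_map => i; rewrite mem_iota /= => lt_i.
have eq_f j : j <= n -> trees_fuel f j = trees_fuel n.+1 j.
  by move=> le_jn; rewrite (IHl f) ?(IHl n.+1) //; lia.
by rewrite !eq_f //; lia.
Qed.

Lemma count_treesS (p p1 p2 : pred tree) n :
    (forall q r, p (Node q r) = p1 q && p2 r) ->
  count p (trees n.+1) = \sum_(i < n.+1) count p1 (trees i) * count p2 (trees (n - i)).
Proof.
move=> p_Node; rewrite /trees trees_fuelS.
have count_Node ss ts : count p [seq Node q r | q <- ss, r <- ts] = count p1 ss * count p2 ts.
  elim: ss => //= q ss IHss; rewrite count_cat IHss mulnDl count_map; congr (_ + _).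
  under eq_count do rewrite /= p_Node.
  by case: (p1 q); rewrite /= ?mul1n // count_pred0.
rewrite count_flatten -map_comp sumnE big_map -[iota 0 n.+1]/(index_iota 0 n.+1).
rewrite big_mkord; apply: eq_bigr => i _; apply: etrans (count_Node _ _) _.
by have lt_i := ltn_ord i; rewrite !trees_fuelE //; lia.
Qed.

(** Multiplicities settle membership and absence of repetitions at once. *)
Lemma count_mem_trees n t : count_mem t (trees n) = (tree_size t == n).
Proof.
elim/ltn_ind: n t => -[|n] IHn t; first by rewrite /= addn0 eq_sym tree_size_eq0.
case: t => [|q r].
  rewrite (@count_treesS _ pred0 pred0) => [|q r]; last by apply/eqP.
  by rewrite big1 // => i _; rewrite count_pred0.
rewrite (@count_treesS _ (pred1 q) (pred1 r)) => [|q' r'] /=; last first.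
  by apply/eqP/andP => [[-> ->]|[/eqP-> /eqP->]].
under eq_bigr => i _ do rewrite !IHn ?ltnS ?leq_ord ?leq_subr //.
rewrite eqSS; case: (ltnP (tree_size q) n.+1) => [lt_q|le_q].
  rewrite (bigD1 (Ordinal lt_q)) //= eqxx mul1n big1 ?addn0.
    by congr nat_of_bool; apply/eqP/eqP; lia.
  by move=> i ne_i; rewrite eq_sym (negPf (ne_i : (i : nat) != tree_size q)).
rewrite big1 => [|i _]; first by case: eqP => //; lia.
by have := ltn_ord i; case: eqP => //; lia.
Qed.

Lemma mem_trees n t : (t \in trees n) = (tree_size t == n).
Proof. by rewrite -has_pred1 has_count count_mem_trees; case: eqP. Qed.

Lemma trees_uniq n : uniq (trees n).
Proof. by apply: count_mem_uniq => t; rewrite count_mem_trees mem_trees. Qed.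

Definition good_count (k m n : nat) : nat := count (good k m) (trees n).

(** A nonempty word that owes a trivial component must start with [UD], which is removed. *)
Lemma good_countSS k m n : good_count k m.+1 n.+1 = good_count k m n.
Proof.
rewrite /good_count (@count_treesS _ (pred1 Leaf) (good k m)); last first.
  by move=> q r; rewrite good_Node /=; case: eqP.
rewrite big_ord_recl big1 => [|i _]; last by rewrite count_mem_trees.
by rewrite count_mem_trees mul1n subn0 addn0.
Qed.

Lemma good_count0S k n : good_count k 0 n.+1 = good_count k 0 n +
  \sum_(i < n.+1) (0 < i) * good_count k (0 < k) i * good_count k k.-1 (n - i).
Proof.
(* [pL] and [pN] separate a trivial first component from a nontrivial one. *)
pose pL (t : tree) := if t is Node Leaf r then good k 0 r else false.
pose pN (t : tree) := if t is Node q r then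
  [&& q != Leaf, good k (0 < k) q & good k k.-1 r] else false.
have -> : good_count k 0 n.+1 = count pL (trees n.+1) + count pN (trees n.+1).
  rewrite -count_predUI [X in _ + X](@eq_count _ _ pred0); last first.
    by case=> [|[|q1 q2] r] //=; rewrite ?eqxx ?andbF.
  rewrite count_pred0 addn0; apply/eq_in_count => -[|q r]; first by rewrite mem_trees.
  by move=> _; rewrite good_Node /=; case: eqP => [->|]; [rewrite orbF | case: q].
rewrite (@count_treesS _ (pred1 Leaf) (good k 0)); last first.
  by move=> [|q1 q2] r //=; case: eqP.
rewrite big_ord_recl big1 => [|i _]; last by rewrite count_mem_trees.
rewrite count_mem_trees mul1n subn0 addn0; congr (_ + _).
rewrite (@count_treesS _ (predI (predC1 Leaf) (good k (0 < k))) (good k k.-1)); last first.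
  by move=> q r /=; rewrite andbA.
apply: eq_bigr => -[[|i] lt_i] _ //=; rewrite mul1n; congr (_ * _).
by apply/eq_in_count => t; rewrite mem_trees /= -tree_size_eq0 => /eqP->.
Qed.

(** * An exponential bound on the number of forests *)

Fixpoint parens (t : tree) : seq bool :=
  if t is Node q r then true :: parens q ++ false :: parens r else [::].

Lemma size_parens t : size (parens t) = (tree_size t).*2.
Proof. by elim: t => //= q IHq r IHr; rewrite size_cat /= IHq IHr; lia. Qed.

(* What follows a parsed forest never opens a bracket, which makes parsing deterministic. *)
Lemma parens_inj : injective parens.
Proof.
suff parse t t' w w' : head false w = false -> head false w' = false ->
    parens t ++ w = parens t' ++ w' -> t = t'.
  by move=> t t' eq_p; apply: (parse t t' [::] [::]) => //; rewrite !cats0.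
elim: t t' w w' => [|q IHq r IHr] [|q' r'] w w' w0 w'0 //=.
- by move=> Ew; rewrite Ew in w0.
- by move=> Ew; rewrite -Ew in w'0.
case=> eq_p; have Eq : q = q'.
  apply: (IHq q' (false :: parens r ++ w) (false :: parens r' ++ w')) => //.
  by rewrite -!catA in eq_p.
move: eq_p; rewrite Eq -!catA => /eqP; rewrite eqseq_cat // eqxx /= eqseq_cons /= => /eqP eq_r.
by rewrite (IHr r' w w').
Qed.

Lemma size_trees n : size (trees n) <= 4 ^ n.
Proof.
rewrite -(size_map parens) (_ : 4 ^ n = size [seq tval b | b <- enum {: n.*2.-tuple bool}]).
  apply: uniq_leq_size; first by rewrite (map_inj_uniq parens_inj) trees_uniq.
  move=> _ /mapP[t t_n ->]; rewrite mem_trees in t_n.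
  have sz_p : size (parens t) == n.*2 by rewrite size_parens (eqP t_n).
  by apply/mapP; exists (Tuple sz_p); rewrite ?mem_enum.
by rewrite size_map -cardE card_tuple card_bool -mul2n expnM.
Qed.

Lemma good_count_le k m n : good_count k m n <= 4 ^ n.
Proof. exact: leq_trans (count_size _ _) (size_trees n). Qed.

(** * Ornamentations of the chain *)

Definition arcs (n : nat) (s : nat -> nat) : {ffun 'I_n -> {set 'I_n}} :=
  [ffun v : 'I_n => [set u : 'I_n | u <= v <= u + s v]].

Lemma in_arcs n s (u v : 'I_n) : (u \in arcs n s v) = (u <= v <= u + s v).
Proof. by rewrite ffunE inE. Qed.

Lemma tle_chain n (x y : 'I_n) : tle (@chain_cov n) x y = (x <= y).
Proof.
apply/idP/idP => [/connectP[p]|].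
  elim: p x => [|z p IHp] x /=; first by move=> _ ->.
  by case/andP=> /eqP Ez /IHp{}IHp /IHp; rewrite Ez; apply: ltnW.
have [l] := ubnP (y - x); elim: l x => // l IHl x lt_l le_xy.
case: (ltngtP x y) le_xy => // [lt_xy|/val_inj-> _]; last exact: connect0.
have lt_x1 : x.+1 < n by apply: leq_ltn_trans lt_xy _.
move=> _; apply: connect_trans (connect1 _) (IHl (Ordinal lt_x1) _ _) => //=; first exact/eqP.
by lia.
Qed.

Definition adj_in n (S : {set 'I_n}) : rel 'I_n :=
  [rel a b | [&& a \in S, b \in S & adj (@chain_cov n) a b]].

(** A path in the chain moves by single steps, so it cannot jump over [z]. *)
Lemma connect_between n (S : {set 'I_n}) (x y z : 'I_n) :
  connect (adj_in S) x y -> x \in S -> x <= z <= y -> z \in S.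
Proof.
case/connectP=> p; elim: p x => [|a p IHp] x /=.
  by move=> _ -> xS le_z; rewrite (_ : z = x) //; apply: ord_inj; lia.
case/andP=> /and3P[_ aS adj_xa] path_p Ey xS le_z.
case: (eqVneq z x) => [->//|ne_zx]; apply: (IHp a) => //.
have {}ne_zx : (z : nat) <> x by move/ord_inj/eqP; rewrite (negPf ne_zx).
by move: adj_xa; rewrite /adj /chain_cov /=; lia.
Qed.

Lemma between_connect n (S : {set 'I_n}) (x y : 'I_n) : x <= y ->
  (forall z : 'I_n, x <= z <= y -> z \in S) -> connect (adj_in S) x y.
Proof.
have [l] := ubnP (y - x); elim: l x => // l IHl x lt_l le_xy in_S.
case: (ltngtP x y) (le_xy) => // [lt_xy _|/val_inj-> _]; last exact: connect0.
have lt_x1 : x.+1 < n by apply: leq_ltn_trans lt_xy _.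
apply: connect_trans (connect1 _) (IHl (Ordinal lt_x1) _ _ _) => //=.
- by rewrite /adj_in /= /adj /chain_cov /= eqxx !in_S //=; lia.
- by lia.
by move=> z le_z; apply: in_S; lia.
Qed.

Lemma adj_in_sym n (S : {set 'I_n}) : connect_sym (adj_in S).
Proof. by apply: sym_connect_sym => x y; rewrite /adj_in /= /adj andbCA orbC. Qed.

Lemma arcs_Orn n s : bracketing n s -> arcs n s \in Orn (@chain_cov n).
Proof.
move=> [s_le s_nest]; rewrite inE; apply/andP; split; apply/forallP => v.
  have v_v : v \in arcs n s v by rewrite in_arcs; lia.
  rewrite /ornament /max_is v_v -andbA; apply/and3P; split.
  - by apply/set0Pn; exists v.
  - apply/forall_inP => x x_v; apply/forall_inP => y y_v.
    rewrite !in_arcs in x_v y_v; rewrite -/(adj_in _).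
    case: (leqP x y) => le_xy; last rewrite adj_in_sym.
      by apply: between_connect => // z le_z; rewrite in_arcs; lia.
    by apply: between_connect => [|z le_z]; [|rewrite in_arcs]; lia.
  - by apply/forall_inP => u; rewrite in_arcs tle_chain; case/andP.
apply/forallP => w; wlog le_vw : v w / v <= w.
  move=> wlg; case: (leqP v w) => [|/ltnW] /wlg //.
  by rewrite /nested_or_disjoint orbCA disjoint_sym.
rewrite /nested_or_disjoint; case: (leqP w (v + s w)) => [w_v|v_w].
  apply/orP; left; apply/subsetP => u; rewrite !in_arcs.
  by have := s_nest v w le_vw (ltn_ord w) w_v; lia.
apply/orP; right; apply/orP; right; rewrite -setI_eq0; apply/eqP/setP => u.
by rewrite !inE !in_arcs; lia.
Qed.

Lemma Orn_arcs n d : d \in Orn (@chain_cov n) -> exists2 s, bracketing n s & d = arcs n s.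
Proof.
rewrite inE => /andP[/forallP d_orn /forallP d_nest].
have d_v v : v \in d v by have /andP[_ /andP[]] := d_orn v.
have d_le v u : u \in d v -> u <= v.
  by have /andP[_ /andP[_ /forall_inP max_v]] := d_orn v => /max_v; rewrite tle_chain.
(* The distance from [v] to the farthest element of [d v], with default [0] off the chain. *)
pose s (v : nat) := if insub v is Some i then \max_(u in d i) (i - u) else 0.
have sE (v : 'I_n) : s v = \max_(u in d v) (v - u) by rewrite /s valK.
have s_min v : exists2 w, w \in d v & s v = v - w.
  have d_gt0 : 0 < #|d v| by apply/card_gt0P; exists v.
  by have [w w_v Ew] := eq_bigmax_cond (fun u : 'I_n => v - u) d_gt0; exists w; rewrite // sE.
have dE v u : (u \in d v) = (u <= v <= u + s v).
  apply/idP/idP => [u_v|le_u].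
    by rewrite d_le //= sE -leq_subLR (bigmax_sup u).
  have [w w_v Es] := s_min v.
  have /andP[/andP[_ /forall_inP conn_v] _] := d_orn v.
  have /forall_inP/(_ v (d_v v)) := conn_v w w_v; rewrite -/(adj_in _).
  by move/connect_between; apply=> //; have := d_le v w w_v; lia.
exists s; last by apply/ffunP => v; apply/setP => u; rewrite in_arcs dE.
split=> [v lt_v|u v le_uv lt_v le_v].
  by have [w _] := s_min (Ordinal lt_v); rewrite /= => ->; apply: leq_subr.
have lt_u := leq_ltn_trans le_uv lt_v.
have [w w_u /= Es] := s_min (Ordinal lt_u).
have /forallP/(_ (Ordinal lt_v)) := d_nest (Ordinal lt_u).
have u_v : Ordinal lt_u \in d (Ordinal lt_v) by rewrite dE /=; lia.
case/or3P=> [/subsetP/(_ w w_u)|/subsetP/(_ _ (d_v _))|].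
- by have := d_le _ _ w_u; rewrite !dE /=; lia.
- by rewrite dE /= => le_vu; have -> : u = v by lia.
by rewrite disjoint_sym disjoint_subset => /subsetP/(_ _ u_v); rewrite !inE d_v.
Qed.

Lemma arcs_ole n s s' : bracketing n s ->
  reflect (forall v, v < n -> s v <= s' v) (ole (arcs n s) (arcs n s')).
Proof.
move=> [s_le _]; apply: (iffP forallP) => [sub v lt_v|le_s v]; last first.
  by apply/subsetP => u; rewrite !in_arcs; have := le_s v (ltn_ord v); lia.
(* The inclusion is tested on the lowest element of the ornament of [v]. *)
have lt_w : v - s v < n by lia.
have /subsetP/(_ (Ordinal lt_w)) := sub (Ordinal lt_v).
by have := s_le v lt_v; rewrite !in_arcs /=; lia.
Qed.

Lemma eq_arcs n s s' : (forall v, v < n -> s v = s' v) -> arcs n s = arcs n s'.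
Proof. by move=> eq_s; apply/ffunP => v; apply/setP => u; rewrite !in_arcs eq_s. Qed.

Lemma arcs_inj n s s' : bracketing n s -> bracketing n s' ->
  arcs n s = arcs n s' -> forall v, v < n -> s v = s' v.
Proof.
move=> br br' eq_a v lt_v; apply/eqP; rewrite eqn_leq; apply/andP; split.
  by apply: (elimT (arcs_ole s' br)) => //; rewrite eq_a; apply/forallP.
by apply: (elimT (arcs_ole s br')) => //; rewrite eq_a; apply/forallP.
Qed.

(** * Lower covers of an ornamentation and its pop *)

Section PopArcs.

Variables (n : nat) (s s' : nat -> nat).
Hypothesis s_br : bracketing n s.
Hypothesis s_pop : forall v, v < n -> popat s v (s' v).

Definition upd (v : nat) : nat -> nat := fun w => if w == v then s' v else s w.

Lemma popat_le v : v < n -> s' v <= s v.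
Proof. by move/s_pop=> [[_ ->] //|[u [Ev Eu _]]]; lia. Qed.

Lemma upd_le v w : v < n -> upd v w <= s w.
Proof. by rewrite /upd; case: eqP => // -> /popat_le. Qed.

Lemma upd_bracketing v : v < n -> bracketing n (upd v).
Proof.
have [s_le s_nest] := s_br => lt_v.
split=> [w lt_w|x y]; first exact: leq_trans (upd_le w lt_v) (s_le w lt_w).
have le_s' := popat_le lt_v.
rewrite /upd; case: (eqVneq y v) => [->|ne_y]; case: (eqVneq x v) => [->|ne_x] //.
  (* If the interval of some [x] after [u] reached [u], it would contain that of [u] and so start
     where that of [v] starts, against the choice of [u] as the last such index. *)
  case: (s_pop lt_v) => [[s0 ->]|[u [Ev Eu max_u]]] le_xv _ lt_x; first by lia.
  have le_ux : u <= x by lia.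
  have := s_nest x v le_xv lt_v; have := s_nest u x le_ux; have := max_u x.
  by lia.
  by move=> le_vy lt_y le_y; have := s_nest v y le_vy lt_y; lia.
exact: s_nest.
Qed.

(* A smaller [s v] would cross the ornament of the first child, which is unchanged in [e]. *)
Lemma first_change_le e v : bracketing n e -> v < n ->
  (forall w, w < v -> e w = s w) -> e v < s v -> e v <= s' v.
Proof.
move=> [_ e_nest] lt_v eq_e lt_e; rewrite leqNgt; apply/negP => lt_s'.
case: (s_pop lt_v) => [[s0 _]|[u [Ev Eu _]]]; first by lia.
have := e_nest u v; have := eq_e u; lia.
Qed.

Lemma upd_lt v : v < n -> 0 < s v -> s' v < s v.
Proof. by case/s_pop=> [[->]//|[u [Ev Eu _]]]; lia. Qed.

(** An element in between agrees with [s] away from [v], so [first_change_le] forces its value at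
    [v] down to [s' v]. *)
Lemma upd_covered v : v < n -> 0 < s v ->
  ocovered (@chain_cov n) (arcs n (upd v)) (arcs n s).
Proof.
move=> lt_v s_gt0; have br_v := upd_bracketing lt_v.
have lt_s := upd_lt lt_v s_gt0.
apply/and4P; split; rewrite ?arcs_Orn //.
  apply/andP; split; last by apply/arcs_ole => // w _; apply: upd_le.
  by apply/eqP => /arcs_inj/(_ v lt_v); rewrite /upd eqxx => E; move: lt_s; rewrite E ?ltnn.
apply/forall_inP => _ /Orn_arcs[e br_e ->]; apply/negP.
case/andP=> /andP[/eqP ne_ve /(arcs_ole _ br_v) le_ve] /andP[/eqP ne_es /(arcs_ole _ br_e) le_es].
have eq_e w : w < n -> w != v -> e w = s w.
  move=> lt_w ne_w; have := le_ve w lt_w; have := le_es w lt_w.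
  by rewrite /upd (negPf ne_w); lia.
have lt_e : e v < s v.
  rewrite ltn_neqAle le_es // andbT; apply/eqP => eq_v; apply: ne_es; apply: eq_arcs => w lt_w.
  by case: (eqVneq w v) => [->//|]; apply: eq_e.
apply: ne_ve; apply: eq_arcs => w lt_w; rewrite /upd.
case: eqVneq => [->|ne_w]; last by rewrite eq_e.
apply/eqP; rewrite eqn_leq first_change_le // ?andbT.
  by have := le_ve v lt_v; rewrite /upd eqxx.
by move=> w' lt_w'; apply: eq_e; lia.
Qed.

(** At the least [v] where [d] is below [s], [first_change_le] puts [d] below [upd v], which is
    strictly below [s]; a cover must then equal it. *)
Lemma covered_upd d : ocovered (@chain_cov n) d (arcs n s) ->
  exists2 v, v < n & d = arcs n (upd v).
Proof.
case/and4P=> /Orn_arcs[e br_e ->] _ /andP[/eqP ne_es /(arcs_ole _ br_e) le_es] /forall_inP no_btw.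
have ex_v : exists v, (v < n) && (e v < s v).
  case: (pickP (fun v : 'I_n => e v < s v)) => [v lt_v|none].
    by exists v; rewrite ltn_ord.
  case: ne_es; apply: eq_arcs => v lt_v.
  by have := none (Ordinal lt_v); have := le_es v lt_v => /=; lia.
case: (ex_minnP ex_v) => v /andP[lt_v lt_e] min_v; exists v => //.
have br_v := upd_bracketing lt_v.
have s_gt0 : 0 < s v by lia.
have /and4P[_ _ lt_vs _] := upd_covered lt_v s_gt0.
apply/eqP; move: (no_btw _ (arcs_Orn br_v)); rewrite lt_vs andbT.
apply: contraR => ne_ev; rewrite /olt ne_ev /=; apply/arcs_ole => // w lt_w.
rewrite /upd; case: eqP => [->|_]; last exact: le_es.
apply: first_change_le => // w' lt_w'.
have := min_v w'; have := le_es w'; lia.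
Qed.

(** Every lower cover is some [upd w] and so lies above [s']; at [v] the bound is attained by
    [upd v], or by [s] itself when [s v = 0]. *)
Lemma Pop_arcs : Pop (@chain_cov n) (arcs n s) = arcs n s'.
Proof.
apply/ffunP => v; rewrite ffunE; apply/setP => x; rewrite inE.
have lt_v := ltn_ord v; have le_s' := popat_le lt_v.
apply/andP/idP => [[x_v /bigcapP x_cov]|x_v].
  case: (posnP (s v)) => [s0|s_gt0].
    by move: x_v; rewrite !in_arcs; lia.
  by have := x_cov _ (upd_covered lt_v s_gt0); rewrite !in_arcs /upd eqxx.
rewrite in_arcs in x_v; split; first by rewrite in_arcs; lia.
apply/bigcapP => _ /covered_upd[w _ ->]; rewrite in_arcs /upd.
by case: eqP => [<-|_]; lia.
Qed.

End PopArcs.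

Definition orn_of_tree (n : nat) (t : tree) : {ffun 'I_n -> {set 'I_n}} :=
  arcs n (nth 0 (code t)).

Lemma orn_of_tree_inj n : {in trees n &, injective (orn_of_tree n)}.
Proof.
move=> t t'; rewrite !mem_trees => /eqP sz_t /eqP sz_t' eq_a; apply: code_inj.
apply: (@eq_from_nth _ 0); rewrite !size_code sz_t ?sz_t' // => v lt_v.
apply: arcs_inj eq_a _ lt_v; first by rewrite -sz_t; apply: code_bracketing.
by rewrite -sz_t'; apply: code_bracketing.
Qed.

Lemma Pop_orn_of_tree n t : tree_size t = n ->
  Pop (@chain_cov n) (orn_of_tree n t) = orn_of_tree n (pop t).
Proof.
move=> <-; apply: Pop_arcs; first exact: code_bracketing.
by rewrite -size_code; case: (popseq_code_pop t).
Qed.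

(** [orn_of_tree] is a bijection from the forests of size [n] to the ornamentations and intertwines
    the two pops. *)
Lemma popChainCountE k n : popChainCount k n = good_count k k n.
Proof.
rewrite /popChainCount /good_count -size_filter -(size_map (orn_of_tree n)).
have iter_pop t j : tree_size t = n ->
    tree_size (iter j pop t) = n /\
    iter j (Pop (@chain_cov n)) (orn_of_tree n t) = orn_of_tree n (iter j pop t).
  by move=> sz_t; elim: j => //= j [sz_j ->]; rewrite tree_size_pop Pop_orn_of_tree.
apply: etrans (card_uniqP _); last first.
  rewrite map_inj_in_uniq ?filter_uniq ?trees_uniq // => t t'.
  by rewrite !mem_filter => /andP[_ t_n] /andP[_ t'_n]; apply: orn_of_tree_inj.
apply: eq_card => d; apply/imsetP/mapP.
  case=> _ /Orn_arcs[s /bracketing_code[t sz_t code_t] ->] ->.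
  have [sz_k eq_k] := iter_pop t k sz_t.
  exists (iter k pop t); last by rewrite -eq_k; congr iter; apply: eq_arcs => v /code_t.
  by rewrite mem_filter mem_trees sz_k eqxx andbT; apply/good_iter_pop; exists t.
case=> t; rewrite mem_filter mem_trees => /andP[/good_iter_pop[t0 <-]] /eqP sz_t ->.
have sz_t0 : tree_size t0 = n by rewrite -sz_t; elim: (k) => //= j ->; rewrite tree_size_pop.
have [_ <-] := iter_pop t0 k sz_t0.
by exists (orn_of_tree n t0) => //; rewrite -sz_t0; apply/arcs_Orn/code_bracketing.
Qed.

(** * The generating function *)

From Stdlib Require Import Reals Lra.
From Coquelicot Require Import Coquelicot.
Open Scope R_scope.

Definition good_coef (k m : nat) : nat -> R := fun n => INR (good_count k m n).

Definition good_gf (k m : nat) (x : R) : R := PSeries (good_coef k m) x.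

Lemma good_coef_bound k m n : 0 <= good_coef k m n <= 4 ^ n.
Proof.
split; first exact: pos_INR.
apply: Rle_trans (le_INR _ _ (elimT leP (good_count_le k m n))) _.
elim: n => [|n IHn]; first exact: Rle_refl.
by rewrite expnS mult_INR [INR 4]/= /=; lra.
Qed.

Lemma Rabs_good_term k m x n : Rabs x <= 1 / 8 ->
  Rabs (good_coef k m n * x ^ n) <= (1 / 2) ^ n.
Proof.
move=> x_le; have [c_ge0 c_le] := good_coef_bound k m n.
rewrite Rabs_mult (Rabs_pos_eq _ c_ge0) -RPow_abs.
apply: Rle_trans (Rmult_le_compat _ _ _ _ c_ge0 _ c_le (Rle_refl _)) _.
  exact/pow_le/Rabs_pos.
rewrite -Rpow_mult_distr; apply: pow_incr.
by have := Rabs_pos x; lra.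
Qed.

Lemma good_CV_radius k m x : Rabs x < 1 / 8 -> Rbar_lt (Rabs x) (CV_radius (good_coef k m)).
Proof.
move=> x_lt; apply: (Rbar_lt_le_trans _ (1 / 8)) => //.
apply: (proj1 (CV_radius_bounded _)); exists 1 => n.
apply: Rle_trans (Rabs_good_term _ _ _ _) _; first by rewrite Rabs_pos_eq; lra.
by rewrite -[X in _ <= X](pow1 n); apply: pow_incr; lra.
Qed.

Lemma ex_series_half : ex_series (fun n => (1 / 2) ^ n).
Proof. by apply: ex_series_geom; rewrite Rabs_pos_eq; lra. Qed.

Lemma Rabs_good_gf_le k m x : Rabs x < 1 / 8 -> Rabs (good_gf k m x) <= 2.
Proof.
move=> x_lt; have abs_cv := CV_disk_inside _ _ (good_CV_radius k m x_lt).
apply: Rle_trans (Series_Rabs _ abs_cv) _.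
rewrite -[2]/(Rplus 1 1) (_ : 1 + 1 = / (1 - 1 / 2)); last by field.
rewrite -Series_geom; last by rewrite Rabs_pos_eq; lra.
apply: Series_le ex_series_half => n; split; first exact: Rabs_pos.
by apply: Rabs_good_term; lra.
Qed.

Lemma good_gf_decr k m x : Rabs x < 1 / 8 ->
  good_gf k m x = 1 + x * PSeries (PS_decr_1 (good_coef k m)) x.
Proof.
by move=> x_lt; rewrite /good_gf PSeries_decr_1 //; apply/CV_radius_inside/good_CV_radius.
Qed.

Lemma good_gfS k m x : Rabs x < 1 / 8 -> good_gf k m.+1 x = 1 + x * good_gf k m x.
Proof.
move=> x_lt; rewrite good_gf_decr //; congr (_ + _ * _).
by apply: PSeries_ext => n; rewrite /PS_decr_1 /good_coef good_countSS.
Qed.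

Lemma INR_sum n (f : nat -> nat) :
  INR (\sum_(i < n.+1) f i)%nat = sum_f_R0 (fun i => INR (f i)) n.
Proof.
elim: n => [|n IHn]; first by rewrite big_ord1.
by rewrite big_ord_recr /= plus_INR IHn.
Qed.

Lemma good_gf0 k x : Rabs x < 1 / 8 ->
  good_gf k 0 x =
  1 + x * (good_gf k 0 x + (good_gf k (0 < k)%nat x - 1) * good_gf k k.-1 x).
Proof.
move=> x_lt; rewrite [LHS]good_gf_decr //; congr (_ + _ * _).
(* The coefficients with the constant term erased, matching the factor [0 < i] in [good_count0S]. *)
pose b : nat -> R := PS_incr_1 (PS_decr_1 (good_coef k (0 < k)%nat)).
have b_gf : PSeries b x = good_gf k (0 < k)%nat x - 1.
  by rewrite PSeries_incr_1 good_gf_decr //; ring.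
have b_cv : Rbar_lt (Rabs x) (CV_radius b).
  by rewrite CV_radius_incr_1 CV_radius_decr_1; apply: good_CV_radius.
have c_cv := good_CV_radius k k.-1 x_lt.
rewrite -b_gf -(PSeries_mult _ _ _ b_cv c_cv) -PSeries_plus; last 2 first.
- exact/CV_radius_inside/good_CV_radius.
- exact: ex_pseries_mult.
apply: PSeries_ext => n; rewrite /PS_decr_1 /PS_plus /PS_mult /good_coef good_count0S.
rewrite plus_INR; congr (_ + _).
rewrite (INR_sum n (fun i => (0 < i) * good_count k (0 < k) i * good_count k k.-1 (n - i))%nat).
apply: sum_eq => i _.
by rewrite mult_INR /b; case: i => [|i]; rewrite /= ?mul0n ?mul1n.
Qed.

(** Solves the recursion [good_gfS] in [m], with the denominator [1 - x] of the geometric sum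
    cleared. *)
Lemma good_gf_geometric k m x : Rabs x < 1 / 8 ->
  (1 - x) * good_gf k m x = 1 - x ^ m + (1 - x) * x ^ m * good_gf k 0 x.
Proof.
move=> x_lt; elim: m => [|m IHm] /=; first by ring.
rewrite good_gfS //; have := f_equal (Rmult x) IHm; lra.
Qed.

Lemma good_gf_quadratic k x : Rabs x < 1 / 8 ->
  (1 - x ^ (k + 1)) * (good_gf k k x - 1) = x * (1 - x) * good_gf k k x ^ 2.
Proof.
move=> x_lt; have := good_gf0 k x_lt; have := good_gf_geometric k k x_lt.
case: k => [|k].
  (* For [k = 0] the recursion is already the Catalan equation [F = 1 + x F^2]. *)
  by move=> _; rewrite -[nat_of_bool _]/0%nat /= => /(f_equal (Rmult (1 - x))); lra.
rewrite -[nat_of_bool _]/1%nat -[k.+1.-1]/k.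
rewrite good_gfS // good_gfS // pow_add /= Rmult_1_r Rmult_1_r.
set G0 := good_gf _ 0 x; set F := 1 + x * _; set p := x * x ^ k => F_G0 G0_F.
(* The recursion reads [G0 = 1 + x G0 F], so multiplying by [1 - x F] eliminates [G0] from
   [F_G0]. *)
have {}G0_F : G0 * (1 - x * F) = 1 by rewrite /F; lra.
have := f_equal (fun y => y * (1 - x * F)) F_G0.
rewrite Rmult_plus_distr_r [(1 - x) * p * G0 * _]Rmult_assoc G0_F.
by lra.
Qed.

Theorem theorem1p3 (k : nat) :
  exists r : R, 0 < r /\
    forall x : R, 0 < Rabs x < r ->
      is_series (fun n : nat => INR (popChainCount k n) * x ^ n)
        ((1 - x ^ (k + 1) -
          sqrt ((1 - x ^ (k + 1)) ^ 2 - 4 * x * (1 - x) * (1 - x ^ (k + 1))))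
         / (2 * x * (1 - x))).
Proof.
(* Coefficients at most [4^n] make the terms at most [(1/2)^n] here, so that [F] is at most [2] in
   absolute value. *)
exists (1 / 8); split; first by lra.
move=> x [x_gt0 x_lt].
have x_neq0 : x <> 0 by move=> x0; rewrite x0 Rabs_R0 in x_gt0; lra.
have [x_ge x_le] := Rabs_def2 _ _ x_lt.
set q := 1 - x ^ (k + 1); set F := good_gf k k x.
have quad : q * (F - 1) = x * (1 - x) * F ^ 2 := good_gf_quadratic k x_lt.
(* Completing the square in the quadratic equation multiplied by [4 x (1 - x)]. *)
have -> : q ^ 2 - 4 * x * (1 - x) * q = Rsqr (q - 2 * x * (1 - x) * F).
  have := f_equal (Rmult (4 * x * (1 - x))) quad; rewrite /Rsqr; lra.
(* This sign selects the root: the quantity is at least [7/8 - 1/2 - 1/16]. *)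
have sub_ge0 : 0 <= q - 2 * x * (1 - x) * F.
  have xk_le : Rabs (x ^ (k + 1)) <= 1 / 8.
    rewrite pow_add Rabs_mult -!RPow_abs pow_1 -[X in _ <= X]Rmult_1_l.
    apply: Rmult_le_compat; [exact/pow_le/Rabs_pos | exact: Rabs_pos | | lra].
    by rewrite -[X in _ <= X](pow1 k); apply: pow_incr; split; [exact: Rabs_pos | lra].
  have := Rabs_good_gf_le k k x_lt; rewrite -/F => F_le.
  have xF_le : Rabs (x * F) <= 1 / 8 * 2.
    by rewrite Rabs_mult; apply: Rmult_le_compat; try exact: Rabs_pos; lra.
  have xxF_le : Rabs (x * (x * F)) <= 1 / 8 * (1 / 8 * 2).
    by rewrite Rabs_mult; apply: Rmult_le_compat; try exact: Rabs_pos; lra.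
  have := Rle_abs (x ^ (k + 1)); have := Rle_abs (x * F).
  by have := Rabs_maj2 (x * (x * F)); rewrite /q; lra.
rewrite sqrt_Rsqr // (_ : (q - _) / _ = F); last by field; split; lra.
apply: (is_series_ext (fun n => good_coef k k n * x ^ n)) => [n|].
  by rewrite popChainCountE.
exact/Series_correct/ex_series_Rabs/CV_disk_inside/good_CV_radius.
Qed.
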